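(* Let $D=(E,\mathcal{F})$ be a set system and let $a,b\in E$ be distinct. Then $|\mathcal{F}|+|\widetilde{\mathcal{F}'}_{ab}|-|\mathcal{F}'_{ab}|-|\widetilde{\mathcal{F}}_{ab}|=0$.
   Context: A set system $D=(E,\mathcal{F})$ is a finite set $E$ with a collection $\mathcal{F}$ of subsets of $E$ (feasible sets). $\triangle$ denotes symmetric difference. For distinct $a,b\in E$ define: $\widetilde{\mathcal{F}}_{ab}=\mathcal{F}\triangle\{F\cup\{a\} : F\cup\{b\}\in\mathcal{F},\ F\subseteq E\setminus\{a,b\}\}$ (handle sliding $a$ over $b$); $\mathcal{F}'_{ab}=\mathcal{F}\triangle\{F\cup\{a,b\} : F\in\mathcal{F},\ F\subseteq E\setminus\{a,b\}\}$ (exchanging handle ends of $a$ and $b$); $\widetilde{\mathcal{F}'}_{ab}=\mathcal{F}\triangle\{F\cup\{a,b\} : F\in\mathcal{F},\ F\subseteq E\setminus\{a,b\}\}\triangle\{F\cup\{a\} : F\cup\{b\}\in\mathcal{F},\ F\subseteq E\setminus\{a,b\}\}$. *)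

(* Defs.v *)
From mathcomp Require Import all_boot all_order all_algebra.

Set Implicit Arguments.
Unset Strict Implicit.
Unset Printing Implicit Defensive.

Definition symdiff (T : finType) (A B : {set T}) : {set T} :=
  (A :\: B) :|: (B :\: A).

(* A set system (E, F) is given by its ground set E : finType and its
   collection of feasible sets F : {set {set E}}. *)
Section HandleMoves.

Variables (E : finType) (F : {set {set E}}) (a b : E).

Definition slide_family : {set {set E}} :=
  [set X :|: [set a] | X in powerset ([set: E] :\: [set a; b])
                     & X :|: [set b] \in F].

Definition exchange_family : {set {set E}} :=
  [set X :|: [set a; b] | X in powerset ([set: E] :\: [set a; b]) & X \in F].

Definition handle_slide : {set {set E}} := symdiff F slide_family.

Definition handle_exchange : {set {set E}} := symdiff F exchange_family.

Definition handle_exchange_slide : {set {set E}} :=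
  symdiff (symdiff F exchange_family) slide_family.

End HandleMoves.

(* Main.v *)
Require Import Defs.
From mathcomp Require Import all_boot all_order all_algebra zify.

(** The slide family and the exchange family are disjoint, because [b] lies in
    every member of the latter and in no member of the former. Hence toggling
    one family does not affect how many sets are gained by toggling the other,
    so the two changes in cardinality add up. *)

(** The two differences are disjoint, and each omits [A :&: B], which is counted once in [#|A|] and
    once in [#|B|]. The additive form avoids truncated subtraction. *)
Lemma card_symdiff (T : finType) (A B : {set T}) :
  #|symdiff A B| + (#|A :&: B|).*2 = #|A| + #|B|.
Proof.
have := cardsUI (A :\: B) (B :\: A).
have -> : (A :\: B) :&: (B :\: A) = set0.
  by apply/setP => x; rewrite !inE; case: (x \in A); case: (x \in B).
rewrite cards0 -[(A :\: B) :|: (B :\: A)]/(symdiff A B).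
have := cardsID B A; have := cardsID A B; rewrite (setIC B A); lia.
Qed.

Lemma symdiffI_disjoint (T : finType) (F A B : {set T}) :
  [disjoint A & B] -> symdiff F A :&: B = F :&: B.
Proof.
move=> dAB; apply/setP => x; rewrite !inE.
have [xA | _] := boolP (x \in A); first by rewrite (disjointFr dAB xA) !andbF.
by rewrite andbF orbF.
Qed.

(** Toggling [B] changes a cardinality by [#|B|] minus twice the overlap with [B], and toggling [A]
    first leaves that overlap unchanged. *)
Lemma card_symdiff_disjoint (T : finType) (F A B : {set T}) :
  [disjoint A & B] ->
  #|F| + #|symdiff (symdiff F A) B| = #|symdiff F A| + #|symdiff F B|.
Proof.
move=> dAB; have := card_symdiff _ (symdiff F A) B.
rewrite (symdiffI_disjoint _ F A B dAB).
have := card_symdiff _ F A; have := card_symdiff _ F B; lia.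
Qed.

Lemma disjoint_exchange_slide (E : finType) (F : {set {set E}}) (a b : E) :
  a <> b -> [disjoint exchange_family F a b & slide_family F a b].
Proof.
move=> hab; rewrite disjoints_subset; apply/subsetP => _ /imsetP[X _ ->].
rewrite inE; apply/negP => /imsetP[Y]; rewrite !inE => /andP[/subsetP sY _].
(* Test a supposed common member at [b]: either [b] is in [Y], which avoids [b], or [b = a]. *)
move/setP/(_ b); rewrite !inE eqxx !orbT => /esym/orP[/sY | /eqP ba].
  by rewrite !inE eqxx orbT.
exact: hab.
Qed.

Theorem theorem3p7 (E : finType) (F : {set {set E}}) (a b : E) (hab : a <> b) :
  ((#|F|)%:Z + (#|handle_exchange_slide F a b|)%:Z
   - (#|handle_exchange F a b|)%:Z - (#|handle_slide F a b|)%:Z = 0)%R.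
Proof.
have := card_symdiff_disjoint _ F _ _ (disjoint_exchange_slide _ F a b hab).
rewrite -/(handle_exchange F a b) -/(handle_slide F a b).
rewrite -/(handle_exchange_slide F a b); lia.
Qed.
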